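(* Let $(\delta_i^2,\widehat{w}_i)_{i=1}^n$ be the generalized eigenvalue-eigenvector pairs of the pencil $(H,\Gamma_{\rm pr}^{-1})$, i.e. $H\widehat{w}_i=\delta_i^2\,\Gamma_{\rm pr}^{-1}\widehat{w}_i$, with the ordering $\delta_i^2\ge\delta_{i+1}^2$ and the normalization $\widehat{w}_i^\top\Gamma_{\rm pr}^{-1}\widehat{w}_j=\delta_{ij}$ (Kronecker delta). Let $L$ be a loss function in the class $\mathcal{L}$, given by $f\in\mathcal{U}$, and let $1\le r\le n$. Then: (i) A minimizer, over all matrices $B\in\mathcal{M}_r$, of the loss $L(\Gamma_{\rm pos},B)$ is given by $$\widehat{\Gamma}_{\rm pos}=\Gamma_{\rm pr}-KK^\top,\qquad KK^\top=\sum_{i=1}^r \delta_i^2\,(1+\delta_i^2)^{-1}\,\widehat{w}_i\widehat{w}_i^\top .$$ The corresponding minimum loss is $$L(\Gamma_{\rm pos},\widehat{\Gamma}_{\rm pos})=f(1)\,r+\sum_{i>r} f\big(1/(1+\delta_i^2)\big).$$ (ii) The minimizer in (i) is unique if the first $r$ eigenvalues of $(H,\Gamma_{\rm pr}^{-1})$ are different.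
   Context: Bayesian linear model: $y\mid x\sim\mathcal{N}(Gx,\Gamma_{\rm obs})$, $x\sim\mathcal{N}(0,\Gamma_{\rm pr})$, where $G\in\mathbb{R}^{m\times n}$ and $\Gamma_{\rm obs}\in\mathbb{R}^{m\times m}$, $\Gamma_{\rm pr}\in\mathbb{R}^{n\times n}$ are symmetric positive definite (SPD). Set $H=G^\top\Gamma_{\rm obs}^{-1}G$ and let $\Gamma_{\rm pos}=(H+\Gamma_{\rm pr}^{-1})^{-1}$ be the posterior covariance matrix. Approximation class: $\mathcal{M}_r=\{\Gamma_{\rm pr}-KK^\top\succ0:\ \mathrm{rank}(K)\le r\}$. Generalized eigenvalues of a pencil $(A,B)$ of SPD matrices are the numbers $\sigma$ with $Av=\sigma Bv$ for some $v\ne0$, counted with multiplicity. Loss functions: $\mathcal{L}$ is the collection of functions $L(A,B)=\sum_{i=1}^n f(\sigma_i)$ of SPD matrices $A,B\in\mathbb{R}^{n\times n}$, where $(\sigma_i)$ are the generalized eigenvalues of the pencil $(A,B)$ and $f\in\mathcal{U}$, with $$\mathcal{U}=\{g\in C^1(\mathbb{R}_+):\ g'(x)(1-x)<0\ \text{for } x\neq1,\ \text{and } \lim_{x\to\infty}g(x)=\infty\},\qquad \mathbb{R}_+=(0,\infty).$$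
   Formalization: In (ii), ''the first r eigenvalues are different'' is taken to mean that each of them differs from all other n−1 eigenvalues (so also δ_r² ≠ δ_{r+1}²); mere distinctness among the first r does not give uniqueness, e.g. n=2, r=1, H=Γ_pr=I. *)

(* Defs.v *)
From HB Require Import structures.
From mathcomp Require Import all_boot all_order all_algebra.
From mathcomp Require Import all_classical all_reals all_analysis.
Import Order.TTheory GRing.Theory Num.Theory.
Import numFieldNormedType.Exports.

Set Implicit Arguments.
Unset Strict Implicit.
Unset Printing Implicit Defensive.

Local Open Scope classical_set_scope.
Local Open Scope ring_scope.

Definition spd (R : realType) (n : nat) (A : 'M[R]_n) : Prop :=
  A^T = A /\ forall x : 'cV[R]_n, x != 0 -> 0 < (x^T *m A *m x) 0 0.

Definition geneigenvalue (R : realType) (n : nat) (A B : 'M[R]_n) (s : R)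
    : Prop :=
  exists v : 'cV[R]_n, v != 0 /\ A *m v = s *: (B *m v).

(* [kermx] is a left kernel, hence the transpose: the rank below is the
   dimension of the space of column vectors v with A v = s B v.  For SPD
   pencils it coincides with the algebraic multiplicity of s. *)
Definition genmult (R : realType) (n : nat) (A B : 'M[R]_n) (s : R) : nat :=
  \rank (kermx (A - s *: B)^T).

(* The sum of f over the generalized eigenvalues counted with multiplicity.
   [\sum_(s \in _)] is the finitely supported sum, which is a genuine finite
   sum because an SPD pencil has at most n generalized eigenvalues. *)
Definition loss (R : realType) (n : nat) (f : R -> R) (A B : 'M[R]_n) : R :=
  \sum_(s \in [set s | geneigenvalue A B s]) f s *+ genmult A B s.

(* Functions on (0, +oo) are represented by total functions of which only the
   values on positive reals are constrained. *)
Definition classU (R : realType) (g : R -> R) : Prop :=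
  [/\ forall x : R, 0 < x -> derivable g x 1,
      forall x : R, 0 < x -> {for x, continuous (derive1 g)},
      forall x : R, 0 < x -> x != 1 -> derive1 g x * (1 - x) < 0
    & g x @[x --> +oo] --> +oo].

Definition hessian (R : realType) (m n : nat) (G : 'M[R]_(m, n))
    (Gobs : 'M[R]_m) : 'M[R]_n :=
  G^T *m invmx Gobs *m G.

Definition posterior_cov (R : realType) (m n : nat) (G : 'M[R]_(m, n))
    (Gobs : 'M[R]_m) (Gpr : 'M[R]_n) : 'M[R]_n :=
  invmx (hessian G Gobs + invmx Gpr).

(* The number of columns of K is unconstrained; only its rank is bounded. *)
Definition classM (R : realType) (n : nat) (Gpr : 'M[R]_n) (r : nat)
    : set 'M[R]_n :=
  [set B | spd B /\ exists (p : nat) (K : 'M[R]_(n, p)),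
     (\rank K <= r)%N /\ B = Gpr - K *m K^T].

Definition minimizer_on (R : realType) (T : Type) (S : set T) (F : T -> R)
    (x : T) : Prop :=
  S x /\ forall y, S y -> F x <= F y.

(* Main.v *)
Require Import Defs.
From HB Require Import structures.
From mathcomp Require Import all_boot all_order all_algebra.
From mathcomp Require Import all_classical all_reals all_analysis.
From mathcomp Require Import perm complex ring zify.
Import Order.TTheory GRing.Theory Num.Theory.
Import numFieldNormedType.Exports.

Set Implicit Arguments.
Unset Strict Implicit.
Unset Printing Implicit Defensive.

Local Open Scope classical_set_scope.
Local Open Scope ring_scope.

(** Why the theorem holds. Put s_i = 1 + delta_i^2. The eigenvectors w_i give a
    congruence T (lemma [whitening]) that carries the posterior covariance to
    the identity and the prior covariance to diag(s). A competitor
    B = Gpr - K K^T is carried to A = diag(s) - M M^T with M = T K of rank at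
    most r, and since generalized eigenvalues are invariant under congruence,
    the loss of B is the sum of f(1/d_i) over the ordinary eigenvalues d_i of
    A ([loss_congruence]). The problem is now to choose a perturbation of rank
    at most r of a diagonal matrix.

    A negative semidefinite perturbation of rank at most r can push the k-th
    largest eigenvalue down to the (k+r)-th largest one, but no further
    ([weyl_lower_bound]). Hence the eigenvalues of A can be numbered so that
    d_i >= s_i >= 1 for every i >= r, the r others being unconstrained
    ([aligned_spectral]). As f decreases on (0,1] and has its strict minimum at
    1, each f(1/d_i) is at least f(1/s_i) when i >= r, and at least f(1) when
    i < r ([loss_bound]). The matrix Ghat is carried to the diagonal matrix
    with r entries 1 followed by the s_i for i >= r, so it attains all these
    bounds at once; the formula for the minimum can be read off.

    For uniqueness, let B be another minimizer. Then every bound is attained,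
    and strict monotonicity of f forces the eigenvalues of A to be 1 (r times)
    and the s_i with i >= r. In particular A >= 1 and
    tr A = r + sum_(i >= r) s_i. Take an orthonormal basis whose last n - r
    vectors lie in the kernel of M M^T. On these A coincides with diag(s), so
    by the Ky Fan trace inequality they contribute at least
    sum_(i >= r) s_i to the trace, while the first r contribute at least 1
    each. Both estimates are therefore equalities. The gap between s_(r-1) and
    s_r makes the equality in Ky Fan's inequality rigid: the last n - r basis
    vectors span the same space as the last n - r coordinate vectors, and on
    it A is diag(s). Equality in the other estimate, together with A >= 1, says
    that A is the identity on the orthogonal complement ([deflated_unique]).

    The spectral theorem for real symmetric matrices is proved by induction on
    the size ([spectral_symmetric]): a real eigenvector is obtained from the
    complex Hermitian case, and a Householder reflection splits it off. *)

(** * The loss as a sum over a diagonalizing basis *)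

Lemma rank_diag_mx (F : fieldType) (n : nat) (d : 'rV[F]_n) :
  \rank (diag_mx d) = (\sum_(i < n) (d 0 i != 0)%R)%N.
Proof.
elim: n d => [|n IH] d; first by rewrite big_ord0 flatmx0 mxrank0.
pose d' : 'rV_(1 + n) := d.
rewrite -[LHS]/(\rank (diag_mx d')) -[in LHS](hsubmxK d') diag_mx_row.
rewrite rank_diag_block_mx IH big_ord_recl; congr (_ + _)%N.
  rewrite rank_rV; congr (nat_of_bool (~~ _));
    apply/eqP/eqP => [/matrixP/(_ 0 0)|d0].
    by rewrite !mxE eqxx mulr1n => <-; congr (d _ _); apply: val_inj.
  by apply/matrixP => i j; rewrite !mxE !ord1 -[RHS](mul0rn _ (0 == 0 :> 'I_1));
     rewrite -d0; congr (d _ _ *+ _); apply: val_inj.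
by apply: eq_bigr => i _; rewrite mxE; congr (d _ _ != 0 : nat); apply: val_inj.
Qed.

Lemma geneigenvalue_genmult (R : realType) (n : nat) (A B : 'M[R]_n) (s : R) :
  geneigenvalue A B s <-> genmult A B s != 0%N.
Proof.
rewrite /genmult mxrank_eq0; split.
  case=> v [v0 Av]; apply: contra_neq v0 => k0.
  have: (v^T <= kermx (A - s *: B)^T)%MS.
    apply/sub_kermxP; rewrite -trmx_mul mulmxBl -scalemxAl Av subrr.
    exact: trmx0.
  by rewrite k0 submx0 => /eqP v0; rewrite -[v]trmxK v0 trmx0.
move/rowV0Pn => [x /sub_kermxP xk x0]; exists x^T; split.
  by apply: contra_neq x0 => x0; rewrite -[x]trmxK x0 trmx0.
apply/eqP; rewrite -subr_eq0 scalemxAl -mulmxBl; apply/eqP.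
by apply: trmx_inj; rewrite trmx_mul trmxK xk trmx0.
Qed.

(** A basis W with A W = B W diag(d) turns A - s B into B W diag(d - s) W^-1,
    whose corank is the number of zeros of d - s. *)
Lemma genmult_diag (R : realType) (n : nat) (A B W : 'M[R]_n) (d : 'rV[R]_n)
    (s : R) :
  B \in unitmx -> W \in unitmx -> A *m W = B *m W *m diag_mx d ->
  genmult A B s = (\sum_(i < n) (d 0 i == s)%R)%N.
Proof.
move=> Bu Wu AW; rewrite /genmult mxrank_ker mxrank_tr.
have e : (A - s *: B) *m W = B *m W *m diag_mx (d - s *: const_mx 1).
  rewrite mulmxBl AW linearB /= mulmxBr linearZ /= diag_const_mx.
  by rewrite -scalemxAl -scalemxAr mulmx1.
have -> : \rank (A - s *: B) = \rank (diag_mx (d - s *: const_mx 1)).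
  have Wf : row_free W by rewrite row_free_unit.
  have BWf : row_full (B *m W) by rewrite row_full_unit unitmx_mul Bu.
  by rewrite -(mxrankMfree _ Wf) e (eqmxMfull _ BWf).
rewrite rank_diag_mx.
have nE : n = (\sum_(i < n) ((d 0 i == s)%R + (d 0 i - s != 0)%R))%N.
  rewrite -[LHS]card_ord -sum1_card; apply: eq_bigr => i _.
  by rewrite subr_eq0; case: eqP.
rewrite [X in (X - _)%N]nE big_split /=.
under [X in (_ - X)%N]eq_bigr do rewrite !mxE mulr1.
by rewrite addnK.
Qed.

(** The loss groups the entries of d by value; as the multiplicities are the
    sizes of the groups, ungrouping gives the plain sum. *)
Lemma loss_diag (R : realType) (n : nat) (f : R -> R) (A B W : 'M[R]_n)
    (d : 'rV[R]_n) :
  B \in unitmx -> W \in unitmx -> A *m W = B *m W *m diag_mx d ->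
  loss f A B = \sum_(i < n) f (d 0 i).
Proof.
move=> Bu Wu AW; rewrite /loss.
pose e := undup [seq d 0 i | i : 'I_n].
have -> : [set s | geneigenvalue A B s] = [set` e].
  apply/seteqP; split => s /=.
    move/geneigenvalue_genmult; rewrite (genmult_diag _ Bu Wu AW) mem_undup.
    apply: contra_neqT => s_e; apply: big1 => i _; apply/eqP; rewrite eqb0.
    by apply: contraNneq s_e => <-; apply/fintype.imageP; exists i.
  rewrite mem_undup => /fintype.imageP [i _ ->]; apply/geneigenvalue_genmult.
  by rewrite (genmult_diag _ Bu Wu AW) (bigD1 i) //= eqxx.
rewrite -fsbig_seq ?undup_uniq //.
under eq_bigr => s _.
  rewrite (genmult_diag _ Bu Wu AW) -sumrMnr.
  under eq_bigr => i _ do rewrite mulrb.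
  over.
rewrite exchange_big /=; apply: eq_bigr => i _.
have die : d 0 i \in e by rewrite mem_undup; apply/fintype.imageP; exists i.
rewrite (bigD1_seq (d 0 i)) ?undup_uniq //= eqxx.
by rewrite big1 ?addr0 // => s /negPf; rewrite eq_sym => ->.
Qed.

(** * The spectral theorem for real symmetric matrices *)

(** Over R[i] the matrix is Hermitian, so it has an eigenvalue that is real;
    as a root of the characteristic polynomial, it is already an eigenvalue of
    the real matrix. *)
Lemma symmetric_eigenvector (R : realType) (n : nat) (A : 'M[R]_n.+1) :
  A^T = A -> exists (a : R) (v : 'rV[R]_n.+1), v != 0 /\ v *m A = a *: v.
Proof.
move=> sA; pose f := real_complex R : {rmorphism R -> R[i]}.
pose AC : 'M[R[i]]_n.+1 := map_mx f A.
have hA : AC \is hermsymmx.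
  apply/is_hermitianmxP; rewrite expr0 scale1r.
  apply/matrixP => i j; rewrite !mxE -[in LHS]sA mxE conj_Creal //.
  by apply/complex_realP; exists (A j i).
have /mxOverP/(_ 0 0) /complex_realP [a ea] := hermitian_spectral_diag_real hA.
have Pu := spectral_unit AC.
have /orthomx_spectralP eA := hermitian_normalmx hA.
have ev : eigenvalue AC (spectral_diag AC 0 0).
  apply/eigenvalueP; exists (row 0 (spectralmx AC)).
    rewrite -row_mul [X in _ *m X]eA !mulmxA mulmxV // mul1mx.
    by apply/rowP => j; rewrite mul_diag_mx !mxE.
  apply: contraTneq Pu => r0; rewrite -row_free_unit -kermx_eq0.
  apply/rowV0Pn; exists (delta_mx 0 0); first by rewrite sub_kermx -rowE r0.
  by apply/eqP => /rowP/(_ 0); rewrite !mxE !eqxx => /eqP; rewrite oner_eq0.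
move: ev; rewrite ea eigenvalue_root_char -map_char_poly fmorph_root.
by rewrite -eigenvalue_root_char => /eigenvalueP [v va v0]; exists a, v.
Qed.

Lemma rownormE (R : pzSemiRingType) (n : nat) (v : 'rV[R]_n) :
  (v *m v^T) 0 0 = \sum_(i < n) v 0 i ^+ 2.
Proof. by rewrite mxE; apply: eq_bigr => i _; rewrite mxE expr2. Qed.

Lemma rownorm_gt0 (R : realDomainType) (n : nat) (v : 'rV[R]_n) :
  (0 < (v *m v^T) 0 0) = (v != 0).
Proof.
rewrite rownormE lt_neqAle sumr_ge0; last by move=> i _; exact: sqr_ge0.
rewrite andbT eq_sym psumr_eq0; last by move=> i _; exact: sqr_ge0.
congr negb; apply/allP/eqP => [v0|-> i _]; last by rewrite mxE expr0n /= eqxx.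
apply/rowP => j; apply/eqP; have := v0 j (mem_index_enum j).
by rewrite sqrf_eq0 mxE.
Qed.

(** The reflection in the hyperplane orthogonal to v - e_0 exchanges the unit
    vectors e_0 and v. *)
Lemma householder (R : realFieldType) (n : nat) (v : 'rV[R]_n.+1) :
  v *m v^T = 1 -> exists2 Q : 'M[R]_n.+1, Q *m Q^T = 1 & delta_mx 0 0 *m Q = v.
Proof.
move=> v1; pose e : 'rV[R]_n.+1 := delta_mx 0 0.
have [ve|ve] := eqVneq v e; first by exists 1; rewrite ?trmx1 ?mulmx1 // ve.
(* Since v and e_0 are unit vectors, |u|^2 = 2 (1 - v_0), so c = 2 / |u|^2. *)
pose u := v - e; pose c := (1 - v 0 0)^-1.
have ee : e *m e^T = 1.
  by rewrite trmx_delta mul_delta_mx; apply/rowP => j; rewrite !ord1 !mxE !eqxx.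
have ev : e *m v^T = (v 0 0)%:M.
  by rewrite -rowE; apply/rowP => j; rewrite !ord1 !mxE eqxx.
have vE : v *m e^T = (v 0 0)%:M.
  by apply: trmx_inj; rewrite trmx_mul trmxK ev tr_scalar_mx.
have uu : u *m u^T = (2 * (1 - v 0 0))%:M.
  rewrite /u linearB /= mulmxBl !mulmxBr v1 ee ev vE.
  by apply/rowP => j; rewrite !ord1 !mxE eqxx !mulr1n; ring.
have v00 : 1 - v 0 0 != 0.
  apply: contraNneq ve => v0; rewrite -subr_eq0 -/u -[_ == _]negbK -rownorm_gt0.
  by rewrite uu v0 mulr0 mxE mul0rn ltxx.
exists (1 - c *: (u^T *m u)); last first.
  have eu : e *m u^T = (v 0 0 - 1)%:M
    by rewrite linearB /= mulmxBr ee ev raddfB.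
  rewrite mulmxBr mulmx1 -/e -scalemxAr mulmxA eu mul_scalar_mx scalerA.
  by rewrite -[v 0 0 - 1]opprB mulrN mulVf // scaleN1r opprK addrC subrK.
set X := u^T *m u.
have XX : X *m X = (2 * (1 - v 0 0)) *: X.
  by rewrite /X -mulmxA [u *m (_ *m _)]mulmxA uu mul_scalar_mx -scalemxAr.
have cc : c * c * (2 * (1 - v 0 0)) = c + c by rewrite /c; field.
have sX : X^T = X by rewrite /X trmx_mul trmxK.
rewrite linearB /= trmx1 [(c *: X)^T]linearZ /= sX.
rewrite mulmxBl mul1mx mulmxBr mulmx1 -scalemxAl -scalemxAr XX !scalerA cc.
by rewrite scalerDl opprB addrK subrK.
Qed.

(** In an orthonormal basis starting with a unit eigenvector, a symmetric
    matrix is block diagonal with a 1 x 1 block, and induction applies to the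
    other block. *)
Lemma spectral_symmetric (R : realType) (n : nat) (A : 'M[R]_n) : A^T = A ->
  exists (P : 'M[R]_n) (d : 'rV[R]_n),
    P *m P^T = 1%:M /\ A = P^T *m diag_mx d *m P.
Proof.
elim: n A => [|n IH] A sA.
  by exists 1%:M, 0; split; apply/matrixP => -[].
have [a [v0 [v0_neq0 v0A]]] := symmetric_eigenvector sA.
have [v v1 vA] : exists2 v : 'rV[R]_n.+1, v *m v^T = 1 & v *m A = a *: v.
  pose t := (v0 *m v0^T) 0 0.
  have t_gt0 : 0 < t by rewrite rownorm_gt0.
  exists ((Num.sqrt t)^-1 *: v0); last by rewrite -scalemxAl v0A !scalerA mulrC.
  rewrite linearZ /= -scalemxAl -scalemxAr scalerA.
  apply/rowP => j; rewrite !ord1 mxE -/t -invfM -expr2 sqr_sqrtr ?ltW //.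
  by rewrite mulVf ?gt_eqF // mxE eqxx.
have [Q QQ Qv] := householder v1.
have QQ' : Q^T *m Q = 1 by rewrite (mulmx1C QQ).
have [B [sB eB eBA]] : exists B : 'M[R]_(1 + n), [/\ B^T = B,
    (delta_mx 0 0 : 'rV_(1 + n)) *m B = a *: delta_mx 0 0 & A = Q^T *m B *m Q].
  exists (Q *m A *m Q^T); split; first by rewrite !trmx_mul trmxK sA mulmxA.
    by rewrite !mulmxA Qv vA -Qv -!scalemxAl -mulmxA QQ mulmx1.
  by rewrite !mulmxA QQ' mul1mx -mulmxA QQ' mulmx1.
(* Row 0 of B is a e_0, and symmetry clears column 0 as well. *)
have rB j : B 0 j = a *+ (j == 0).
  by have /rowP/(_ j) := eB; rewrite -rowE !mxE eqxx mulr_natr => ->.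
have l0 : lshift n 0 = 0 :> 'I_(1 + n) by apply: val_inj.
have uB : ursubmx B = 0.
  by apply/matrixP => i j; rewrite !mxE ord1 l0 rB mulr0n.
have ulB : ulsubmx B = a%:M.
  by apply/matrixP => i j; rewrite !mxE !ord1 l0 rB.
have dB : dlsubmx B = 0 by rewrite -[LHS]trmxK trmx_dlsub sB uB trmx0.
have sdB : (drsubmx B)^T = drsubmx B by rewrite trmx_drsub sB.
have [P [d [PP eP]]] := IH (drsubmx B) sdB.
pose P' : 'M[R]_(1 + n) := block_mx 1%:M 0 0 P.
have P'P' : P' *m P'^T = 1%:M.
  rewrite tr_block_mx !trmx0 trmx1 mulmx_block PP !mulmx0 !mul0mx mulmx1 !addr0
    add0r.
  by rewrite -scalar_mx_block.
have eB' : B = P'^T *m diag_mx (row_mx a%:M d) *m P'.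
  rewrite diag_mx_row /P' tr_block_mx !trmx0 trmx1 !mulmx_block.
  rewrite !mulmx0 !mul0mx !mulmx1 !mul1mx !addr0 !add0r -eP.
  rewrite -[LHS]submxK uB dB ulB; congr (block_mx _ _ _ _).
    by apply/matrixP => i j; rewrite !mxE !ord1 eqxx.
  by rewrite mul0mx.
pose d' : 'rV[R]_(1 + n) := row_mx a%:M d; exists (P' *m Q), d'; split.
  by rewrite trmx_mul mulmxA -[P' *m Q *m Q^T]mulmxA QQ mulmx1.
by rewrite eBA eB' trmx_mul !mulmxA.
Qed.

(** * Quadratic forms and reordering of a spectral decomposition *)

Lemma spectral_entry (R : pzSemiRingType) (n : nat) (P : 'M[R]_n) (d : 'rV[R]_n)
    (i j : 'I_n) :
  (P^T *m diag_mx d *m P) i j = \sum_(k < n) P k i * d 0 k * P k j.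
Proof.
rewrite -mulmxA mxE; apply: eq_bigr => k _.
by rewrite mul_diag_mx !mxE mulrA.
Qed.

Lemma spectral_quad (R : comPzRingType) (n : nat) (P : 'M[R]_n)
    (d x : 'rV[R]_n) :
  (x *m (P^T *m diag_mx d *m P) *m x^T) 0 0
  = \sum_(k < n) d 0 k * (x *m P^T) 0 k ^+ 2.
Proof.
have -> : x *m (P^T *m diag_mx d *m P) *m x^T
    = x *m P^T *m diag_mx d *m (x *m P^T)^T by rewrite trmx_mul trmxK !mulmxA.
rewrite mxE; apply: eq_bigr => k _;
  rewrite mul_mx_diag [in LHS]mxE [_^T _ _]mxE.
by ring.
Qed.

Lemma diag_quad (R : comPzRingType) (n : nat) (d x : 'rV[R]_n) :
  (x *m diag_mx d *m x^T) 0 0 = \sum_(k < n) d 0 k * x 0 k ^+ 2.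
Proof.
by rewrite -[diag_mx d]mulmx1 -[diag_mx d]mul1mx -{1}trmx1 spectral_quad trmx1
  mulmx1.
Qed.

Lemma rownorm_orthogonal (R : comNzRingType) (n : nat) (P : 'M[R]_n)
    (x : 'rV[R]_n) :
  P *m P^T = 1%:M -> \sum_(k < n) (x *m P^T) 0 k ^+ 2 = \sum_(k < n) x 0 k ^+ 2.
Proof.
move=> /mulmx1C PP; rewrite -!rownormE trmx_mul trmxK.
by rewrite !mulmxA -[_ *m P^T *m _]mulmxA PP mulmx1.
Qed.

Lemma spectral_perm (R : comPzRingType) (n : nat) (s : 'S_n) (P : 'M[R]_n)
    (d : 'rV[R]_n) :
  (row_perm s P)^T *m diag_mx (col_perm s d) *m row_perm s P
  = P^T *m diag_mx d *m P.
Proof.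
apply/matrixP => i j; rewrite !spectral_entry [RHS](reindex_perm s) /=.
by apply: eq_bigr => k _; rewrite !mxE.
Qed.

Lemma orthogonal_row_perm (R : comNzRingType) (n : nat) (s : 'S_n)
    (P : 'M[R]_n) :
  P *m P^T = 1%:M -> row_perm s P *m (row_perm s P)^T = 1%:M.
Proof.
move=> PP; rewrite row_permE trmx_mul tr_perm_mx mulmxA -[_ *m P *m _]mulmxA PP.
by rewrite mulmx1 -perm_mxM mulgV perm_mx1.
Qed.

Lemma sorting_perm (disp : Order.disp_t) (T : orderType disp) (n : nat)
    (f : 'I_n -> T) :
  exists s : 'S_n, forall i j : 'I_n, (i <= j)%N -> (f (s j) <= f (s i))%O.
Proof.
pose t := [tuple f i | i < n]; pose u := sort_tuple (fun x y => y <= x)%O t.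
have /tuple_permP [s us] : perm_eq u t by rewrite perm_sort.
exists s => i j ij.
have usE k : f (s k) = nth (f i) u k.
  by rewrite us (nth_map k) ?size_enum_ord // nth_ord_enum tnth_mktuple.
rewrite !usE; have u_sorted : sorted (fun x y => y <= x)%O u.
  by apply: sort_sorted => x y; apply: le_total.
apply: (sorted_leq_nth _ _ _ u_sorted) => //.
- by move=> y x z yx zy; apply: le_trans zy yx.
- by rewrite inE size_tuple.
- by rewrite inE size_tuple.
Qed.

(** Shifting indices by r; the values at i < r are whatever makes the map
    bijective (a cyclic rotation). *)
Lemma rotation_perm (n r : nat) : (r <= n)%N ->
  exists s : 'S_n, forall i : 'I_n, (r <= i)%N -> s i = (i - r)%N :> nat.
Proof.
move=> rn; have n_gt0 (i : 'I_n) : (0 < n)%N.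
  exact: leq_ltn_trans (ltn_ord i).
pose t (i : 'I_n) := Ordinal (ltn_pmod (i + (n - r)) (n_gt0 i)).
have t_inj : injective t.
  move=> i j /(congr1 val) /eqP /=; rewrite eqn_modDr !modn_small // => /eqP.
  exact: val_inj.
exists (perm t_inj) => i ri; rewrite permE /=.
have -> : (i + (n - r) = n + (i - r))%N by lia.
by rewrite modnDl modn_small // (leq_ltn_trans (leq_subr _ _)).
Qed.

(** * Eigenvalues under perturbations of bounded rank *)

Lemma pid_mx_diag (R : pzSemiRingType) (n r : nat) :
  pid_mx r = diag_mx (\row_k (k < r)%:R) :> 'M[R]_n.
Proof.
apply/matrixP => i j; rewrite !mxE.
by case: (eqVneq i j) => [->|/negPf ij]; rewrite ?eqxx // (inj_eq val_inj) ij.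
Qed.

Lemma copid_mx_diag (R : pzRingType) (n r : nat) :
  copid_mx r = diag_mx (\row_k (r <= k)%:R) :> 'M[R]_n.
Proof.
rewrite /copid_mx pid_mx_diag; apply/matrixP => i j; rewrite !mxE -mulrnBl.
by congr (_ *+ _); case: leqP; rewrite ?subrr ?subr0.
Qed.

Lemma mxrank_row_mx (F : fieldType) (m n p : nat) (A : 'M[F]_(m, n))
    (B : 'M[F]_(m, p)) :
  (\rank (row_mx A B) <= \rank A + \rank B)%N.
Proof.
rewrite -mxrank_tr tr_row_mx -(mxrank_tr A) -(mxrank_tr B) -addsmxE.
exact: mxrank_adds_leqif.
Qed.

(** Weyl's inequality. The conditions that x be orthogonal to the first i
    eigenvectors of diag(s) - M M^T, be supported on the coordinates up to j,
    and be killed by M impose at most i + (n - j - 1) + r < n linear equations,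
    so some x != 0 satisfies them all. For this x both quadratic forms agree:
    one is at least s_j |x|^2, the other at most d_i |x|^2. *)
Lemma weyl_lower_bound (R : realFieldType) (n p : nat) (s d : 'rV[R]_n)
    (P : 'M[R]_n) (M : 'M[R]_(n, p)) (r : nat) (i j : 'I_n) :
  P *m P^T = 1%:M -> diag_mx s - M *m M^T = P^T *m diag_mx d *m P ->
  (forall k l : 'I_n, (k <= l)%N -> s 0 l <= s 0 k) ->
  (forall k l : 'I_n, (k <= l)%N -> d 0 l <= d 0 k) ->
  (\rank M <= r)%N -> (i + r <= j)%N -> s 0 j <= d 0 i.
Proof.
move=> PP eA s_sorted d_sorted rM ij.
pose C1 : 'M[R]_n := P^T *m pid_mx i; pose C2 : 'M[R]_n := copid_mx j.+1.
pose C := row_mx (row_mx C1 C2) M.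
have rC : (\rank C < n)%N.
  apply: leq_ltn_trans (mxrank_row_mx _ _) _.
  apply: leq_ltn_trans (leq_add (mxrank_row_mx _ _) rM) _.
  rewrite rank_copid_mx //.
  have ri : (\rank C1 <= i)%N.
    by apply: leq_trans (mxrankM_maxr _ _) _; rewrite rank_pid_mx // ltnW.
  by have := ltn_ord j; lia.
have /rowV0Pn [x /sub_kermxP xC x0] : kermx C != 0.
  by rewrite kermx_eq0 /row_free ltn_eqF.
move: xC; rewrite !mul_mx_row -row_mx0 => /eq_row_mx [].
rewrite -row_mx0 => /eq_row_mx [x1 x2] xM.
have lo (k : 'I_n) : (k < i)%N -> (x *m P^T) 0 k = 0.
  move=> ki; have /rowP/(_ k) := x1.
  by rewrite mulmxA pid_mx_diag mul_mx_diag !mxE ki mulr1.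
have hi (k : 'I_n) : (j < k)%N -> x 0 k = 0.
  move=> jk; have /rowP/(_ k) := x2.
  by rewrite /C2 copid_mx_diag mul_mx_diag !mxE jk mulr1.
have xx : 0 < \sum_(k < n) x 0 k ^+ 2 by rewrite -rownormE rownorm_gt0.
rewrite -(ler_pM2r xx).
apply: (@le_trans _ _ ((x *m diag_mx s *m x^T) 0 0)).
  rewrite diag_quad mulr_sumr; apply: ler_sum => k _.
  have [kj|jk] := leqP k j; first by rewrite ler_wpM2r ?sqr_ge0 ?s_sorted.
  by rewrite hi // expr0n !mulr0.
have -> : x *m diag_mx s *m x^T = x *m (diag_mx s - M *m M^T) *m x^T.
  by rewrite mulmxBr mulmxA xM mul0mx subr0.
rewrite eA spectral_quad -(rownorm_orthogonal x PP) mulr_sumr.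
apply: ler_sum => k _.
have [ik|ki] := leqP i k; first by rewrite ler_wpM2r ?sqr_ge0 ?d_sorted.
by rewrite lo // expr0n !mulr0.
Qed.

(** The eigenvalues are first sorted and then rotated by r places: Weyl's
    inequality compares s_i with the (i-r)-th largest eigenvalue, which the
    rotation moves to the index i. With this numbering the comparison is
    termwise, and the r smallest eigenvalues occupy the indices i < r. *)
Lemma aligned_spectral (R : realType) (n p : nat) (s : 'rV[R]_n)
    (M : 'M[R]_(n, p)) (r : nat) :
  (forall k l : 'I_n, (k <= l)%N -> s 0 l <= s 0 k) ->
  (\rank M <= r)%N -> (r <= n)%N ->
  exists (P : 'M[R]_n) (d : 'rV[R]_n),
    [/\ P *m P^T = 1%:M, diag_mx s - M *m M^T = P^T *m diag_mx d *m P
      & forall i : 'I_n, (r <= i)%N -> s 0 i <= d 0 i].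
Proof.
move=> s_sorted rM rn.
have sA : (diag_mx s - M *m M^T)^T = diag_mx s - M *m M^T.
  by rewrite linearB /= tr_diag_mx trmx_mul trmxK.
have [P [d [PP eA]]] := spectral_symmetric sA.
have [t ht] := sorting_perm (d 0).
have [u hu] := rotation_perm rn.
have P'P' := orthogonal_row_perm t PP.
exists (row_perm u (row_perm t P)), (col_perm u (col_perm t d)); split.
- exact: orthogonal_row_perm.
- by rewrite !spectral_perm.
move=> i ri; rewrite -(spectral_perm t) in eA.
rewrite mxE; apply: (weyl_lower_bound P'P' eA s_sorted _ rM).
  by move=> k l kl; rewrite !mxE; apply: ht.
by rewrite hu // subnK.
Qed.

(** * Comparison of losses *)

Lemma classU_decreasing (R : realType) (f : R -> R) (x y : R) :
  classU f -> 0 < x -> x < y -> y <= 1 -> f y < f x.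
Proof.
move=> [f_der _ f_sgn _] x0 xy y1.
have pos z : z \in `[x, 1] -> 0 < z.
  by rewrite in_itv => /andP[xz _]; apply: lt_le_trans xz.
have fc : {within `[x, 1], continuous f}.
  by apply: derivable_within_continuous => z /pos; apply: f_der.
apply: (ltr0_derive1_lt_cc _ _ fc) => //.
- by move=> z /subset_itv_oo_cc/pos; apply: f_der.
- move=> z zI; have /= /andP[_ z1] := zI; have := subset_itv_oo_cc zI.
  move=> /pos/f_sgn; rewrite lt_eqF // => /(_ isT).
  by rewrite pmulr_llt0 // subr_gt0.
- by rewrite in_itv /= (ltW xy).
- by rewrite in_itv /= lexx (le_trans (ltW xy)).
Qed.

(** The derivative is positive to the right of 1 and negative on (0,1). *)
Lemma classU_gt1 (R : realType) (f : R -> R) (x : R) :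
  classU f -> 0 < x -> x != 1 -> f 1 < f x.
Proof.
move=> fU x0; rewrite neq_lt => /orP[x1|x1];
  first exact: classU_decreasing fU x0 x1 _.
have [f_der _ f_sgn _] := fU.
have pos z : z \in `[1, x] -> 0 < z.
  by rewrite in_itv => /andP[xz _]; apply: lt_le_trans xz.
have fc : {within `[1, x], continuous f}.
  by apply: derivable_within_continuous => z /pos; apply: f_der.
apply: (gtr0_derive1_lt_cc _ _ fc) => //.
- by move=> z /subset_itv_oo_cc/pos; apply: f_der.
- move=> z zI; have /= /andP[z1 _] := zI; have := subset_itv_oo_cc zI.
  move=> /pos/f_sgn; rewrite gt_eqF // => /(_ isT).
  by rewrite nmulr_llt0 // subr_lt0.
- by rewrite in_itv /= lexx ltW.
- by rewrite in_itv /= lexx ltW.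
Qed.

(** If a termwise inequality sums to an equality, it is an equality in every
    term. All the equality cases below go through this principle. *)
Lemma sum_ge_eq (R : numDomainType) (I : finType) (F G : I -> R) :
  (forall i, F i <= G i) -> \sum_i G i <= \sum_i F i -> forall i, F i = G i.
Proof.
move=> FG GF i; apply/eqP; rewrite eq_sym -subr_eq0; apply/eqP.
have FG0 j : true -> 0 <= G j - F j by rewrite subr_ge0.
apply: (psumr_eq0P FG0) => //; rewrite sumrB; apply/eqP.
by rewrite subr_eq0 eq_le GF ler_sum.
Qed.

(** The best spectrum reachable from a nonincreasing s >= 1 by a perturbation
    of rank r: the r largest values are lowered to 1, where f is minimal. *)
Definition deflated (R : realType) (n : nat) (s : 'rV[R]_n) (r : nat)
    : 'rV[R]_n :=
  \row_i (if (i < r)%N then 1 else s 0 i).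

Section LossBound.
Variables (R : realType) (n : nat) (f : R -> R) (s d : 'rV[R]_n) (r : nat).
Hypotheses (fU : classU f) (s_ge1 : forall i, 1 <= s 0 i)
    (d_gt0 : forall i, 0 < d 0 i).
Hypothesis sd : forall i : 'I_n, (r <= i)%N -> s 0 i <= d 0 i.

Lemma loss_term_lt (i : 'I_n) : deflated s r 0 i != d 0 i ->
  f (deflated s r 0 i)^-1 < f (d 0 i)^-1.
Proof.
rewrite mxE; case: ltnP => [_|ri] cd.
  by rewrite invr1; apply: classU_gt1; rewrite ?invr_gt0 // invr_eq1 eq_sym.
have s_gt0 : 0 < s 0 i by apply: lt_le_trans (s_ge1 i).
apply: classU_decreasing => //; rewrite ?invr_gt0 ?invf_le1 //.
by rewrite ltf_pV2 ?posrE // lt_neqAle cd sd.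
Qed.

Lemma loss_term_le (i : 'I_n) : f (deflated s r 0 i)^-1 <= f (d 0 i)^-1.
Proof. by have [->|/loss_term_lt/ltW] := eqVneq (deflated s r 0 i) (d 0 i). Qed.

Lemma loss_bound : \sum_i f (deflated s r 0 i)^-1 <= \sum_i f (d 0 i)^-1.
Proof. by apply: ler_sum => i _; apply: loss_term_le. Qed.

Lemma loss_bound_eq : \sum_i f (d 0 i)^-1 <= \sum_i f (deflated s r 0 i)^-1 ->
  d = deflated s r.
Proof.
move=> df; apply/rowP => i; apply/eqP; rewrite eq_sym; apply/negPn/negP.
by move=> /loss_term_lt; rewrite (sum_ge_eq loss_term_le df) ltxx.
Qed.

End LossBound.

(** * Rigidity of the optimal perturbation *)

(** If A >= 1, then equality of the forms of A and of the identity at x means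
    that x has components only along eigenvectors of eigenvalue 1. *)
Lemma spectral_fixed_vector (R : realFieldType) (n : nat) (P : 'M[R]_n)
    (d x : 'rV[R]_n) :
  P *m P^T = 1%:M -> (forall i, 1 <= d 0 i) ->
  let A := P^T *m diag_mx d *m P in
  (x *m x^T) 0 0 <= (x *m A *m x^T) 0 0 /\
  ((x *m A *m x^T) 0 0 <= (x *m x^T) 0 0 -> x *m A = x).
Proof.
move=> PP d1 A; rewrite /A spectral_quad rownormE -(rownorm_orthogonal x PP).
have le_term i : (x *m P^T) 0 i ^+ 2 <= d 0 i * (x *m P^T) 0 i ^+ 2.
  by rewrite ler_peMl ?sqr_ge0.
split; first exact: ler_sum.
move=> /(sum_ge_eq le_term) eq_term.
have -> : x *m (P^T *m diag_mx d *m P) = x *m P^T *m diag_mx d *m P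
  by rewrite !mulmxA.
suff -> : x *m P^T *m diag_mx d = x *m P^T
  by rewrite -mulmxA (mulmx1C PP) mulmx1.
apply/rowP => i; rewrite mul_mx_diag mxE; apply/eqP.
have := eq_term i; set y := (x *m P^T) 0 i.
have [->|y0] := eqVneq y 0; first by rewrite mul0r.
rewrite -[LHS]mul1r => /mulIf <-; first by rewrite mulr1.
by rewrite expf_neq0.
Qed.

Lemma row_mul_tr (R : pzSemiRingType) (n p : nat) (A B : 'M[R]_(n, p))
    (k : 'I_n) :
  (row k A *m (row k B)^T) 0 0 = (A *m B^T) k k.
Proof. by rewrite !mxE; apply: eq_bigr => i _; rewrite !mxE. Qed.

(** The spectrum alone determines the perturbed matrix when some c separates
    the first r entries of s from the others. At work are the
    values q_k of the form of A on an orthonormal basis U adapted to M M^T, and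
    p_i, the squared length of the projection of the i-th coordinate vector
    onto the last n - r basis vectors. The identity
      sum_(k < r) (q_k - 1) + sum_i (p_i - [r <= i]) (s_i - c) = 0
    restates tr A = r + sum_(i >= r) s_i, and all its terms are nonnegative. *)
Lemma deflated_unique (R : realType) (n p : nat) (s : 'rV[R]_n) (P : 'M[R]_n)
    (M : 'M[R]_(n, p)) (r : nat) (c : R) :
  P *m P^T = 1%:M ->
  diag_mx s - M *m M^T = P^T *m diag_mx (deflated s r) *m P ->
  (\rank M <= r)%N -> (r <= n)%N -> (forall i, 1 <= s 0 i) ->
  (forall i : 'I_n, (i < r)%N -> c < s 0 i) ->
  (forall i : 'I_n, (r <= i)%N -> s 0 i <= c) ->
  diag_mx s - M *m M^T = diag_mx (deflated s r).
Proof.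
move=> PP eA rM rn s1 cs sc.
have deflated_ge1 i : 1 <= deflated s r 0 i by rewrite mxE; case: ifP.
(* The alignment for s = 0, applied to - M M^T, numbers its eigenvalues v so
   that v_k >= 0 for k >= r; they are also <= 0, hence zero. *)
have [|U [v [UU eN v0]]] := @aligned_spectral R n p 0 M r _ rM rn.
  by move=> k l _; rewrite !mxE.
have UU' : U^T *m U = 1%:M := mulmx1C UU.
have rowU k : (row k U *m (row k U)^T) 0 0 = 1.
  by rewrite row_mul_tr UU mxE eqxx.
have UM (k : 'I_n) : (r <= k)%N -> row k U *m (M *m M^T) = 0.
  move=> rk; suff yM : row k U *m M = 0 by rewrite mulmxA yM mul0mx.
  apply/eqP; rewrite -[_ == _]negbK -rownorm_gt0 -leNgt trmx_mul -mulmxA.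
  rewrite [M *m _]mulmxA.
  have -> : M *m M^T = - (U^T *m diag_mx v *m U)
    by rewrite -eN raddf0 sub0r opprK.
  rewrite mulNmx mulmxN mxE oppr_le0 mulmxA -row_mul !mulmxA UU mul1mx row_mul
    row_diag_mx.
  rewrite -scalemxAl -rowE -scalemxAl mxE rowU mulr1.
  by have := v0 k rk; rewrite mxE.
pose A := diag_mx s - M *m M^T.
pose q k := (row k U *m A *m (row k U)^T) 0 0.
pose p_ i := \sum_(k < n | (r <= k)%N) U k i ^+ 2.
have colU i : \sum_k U k i ^+ 2 = 1.
  transitivity ((U^T *m U) i i); last by rewrite UU' mxE eqxx.
  by rewrite mxE; apply: eq_bigr => k _; rewrite mxE expr2.
have q_ge1 k : 1 <= q k.
  rewrite -(rowU k) /q /A eA.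
  by have [] := spectral_fixed_vector (row k U) PP deflated_ge1.
have q_hi (k : 'I_n) : (r <= k)%N -> q k = \sum_i s 0 i * U k i ^+ 2.
  move=> rk; rewrite /q /A mulmxBr UM // subr0 diag_quad.
  by apply: eq_bigr => i _; rewrite mxE.
have sum_q : \sum_k q k = \sum_i deflated s r 0 i.
  transitivity (\tr (U *m A *m U^T)).
    by apply: eq_bigr => k _; rewrite /q -row_mul row_mul_tr.
  rewrite mxtrace_mulC mulmxA UU' mul1mx /A eA mxtrace_mulC mulmxA PP mul1mx.
  by rewrite mxtrace_diag.
have sum_p : \sum_i p_ i = \sum_(i < n) (r <= i)%:R.
  rewrite exchange_big /= big_mkcond /=; apply: eq_bigr => k _.
  case: leqP => // _; transitivity ((row k U *m (row k U)^T) 0 0);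
    last exact: rowU.
  rewrite rownormE.
  by apply: eq_bigr => i _; rewrite mxE.
have p_ge0 i : 0 <= p_ i by apply: sumr_ge0 => k _; rewrite sqr_ge0.
have p_le1 i : p_ i <= 1.
  rewrite -(colU i) [leRHS](bigID (fun k : 'I_n => (r <= k)%N)) /= lerDl.
  by rewrite sumr_ge0 // => k _; rewrite sqr_ge0.
pose F (i : 'I_n) :=
  (if (i < r)%N then q i - 1 else 0) + (p_ i - (r <= i)%:R) * (s 0 i - c).
have F1_ge0 (i : 'I_n) : 0 <= (if (i < r)%N then q i - 1 else 0).
  by case: ifP => // _; rewrite subr_ge0.
have F2_ge0 (i : 'I_n) : 0 <= (p_ i - (r <= i)%:R) * (s 0 i - c).
  case: leqP => [ri|ir]; first by rewrite mulr_le0 // subr_le0 ?sc.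
  by rewrite subr0 mulr_ge0 // subr_ge0 ltW ?cs.
have F_ge0 i : true -> 0 <= F i by move=> _; rewrite addr_ge0.
have sumF : \sum_i F i = 0.
  have sum_ps : \sum_i p_ i * s 0 i
      = \sum_(k < n) if (r <= k)%N then q k else 0.
    rewrite -big_mkcond /= (eq_bigr _ q_hi) exchange_big /=.
    apply: eq_bigr => i _.
    by rewrite mulr_suml; apply: eq_bigr => k _; rewrite mulrC.
  have Fe i : F i =
      (if (i < r)%N then q i else 0) + p_ i * s 0 i - deflated s r 0 i
      - c * (p_ i - (r <= i)%:R).
    by rewrite /F mxE; case: leqP => _ /=; ring.
  have ps0 : \sum_(i < n) c * (p_ i - (r <= i)%:R) = 0.
    by rewrite -mulr_sumr sumrB sum_p subrr mulr0.
  rewrite (eq_bigr _ (fun i _ => Fe i)) sumrB ps0 subr0.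
  rewrite sumrB big_split /= sum_ps -big_split /= -sum_q; apply/eqP.
  rewrite subr_eq0; apply/eqP/eq_bigr => k _.
  by case: leqP; rewrite ?addr0 ?add0r.
have F0 i : F i = 0 by apply: (psumr_eq0P F_ge0 sumF).
have q1 (k : 'I_n) : (k < r)%N -> q k = 1.
  move=> kr; have /eqP := F0 k; rewrite paddr_eq0 // kr subr_eq0.
  by case/andP => /eqP.
have p0 (i : 'I_n) : (i < r)%N -> p_ i = 0.
  move=> ir; have /eqP := F0 i; rewrite paddr_eq0 // => /andP[_].
  rewrite leqNgt ir /= subr0 mulf_eq0 => /orP[/eqP //|].
  by rewrite subr_eq0 gt_eqF ?cs.
(* For i >= r the weights are at most 1 and sum up to n - r. *)
have p1 (i : 'I_n) : (r <= i)%N -> p_ i = 1.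
  have le_term (j : 'I_n) : p_ j <= (r <= j)%:R.
    by case: leqP => // /p0 ->.
  by move=> ri; rewrite (sum_ge_eq le_term) ?sum_p ?lexx // ri.
have U_hi_lo (k i : 'I_n) : (r <= k)%N -> (i < r)%N -> U k i = 0.
  move=> rk /p0 pi0; apply/eqP; rewrite -sqrf_eq0; apply/eqP.
  by apply: (psumr_eq0P _ pi0) => // j _; rewrite sqr_ge0.
have U_lo_hi (k i : 'I_n) : (k < r)%N -> (r <= i)%N -> U k i = 0.
  move=> kr /p1 pi1; apply/eqP; rewrite -sqrf_eq0; apply/eqP.
  have := colU i; rewrite (bigID (fun k : 'I_n => (r <= k)%N)) /= -/(p_ i) pi1.
  move/eqP; rewrite -subr_eq0 addrAC subrr add0r => /eqP sum0.
  apply: (psumr_eq0P _ sum0) => [j _|]; first by rewrite sqr_ge0.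
  by rewrite -ltnNge.
(* A and the diagonal matrix agree on every row of U, an orthonormal basis. *)
suff UA : U *m A = U *m diag_mx (deflated s r).
  by rewrite -[LHS]mul1mx -UU' -mulmxA UA mulmxA UU' mul1mx.
apply/row_matrixP => k; rewrite !row_mul.
case: (leqP r k) => [rk|kr].
  rewrite mulmxBr UM // subr0; apply/rowP => i; rewrite !mul_mx_diag !mxE.
  by case: ltnP => // ir; rewrite U_hi_lo // !mul0r.
rewrite /A eA; have [_ -> ] := spectral_fixed_vector (row k U) PP deflated_ge1.
  apply/rowP => i; rewrite mul_mx_diag !mxE.
  by case: ltnP => [|ri]; rewrite ?mulr1 // U_lo_hi // mul0r.
by rewrite -eA -/A -/(q k) q1 // rowU.
Qed.

(** * Congruences *)

(** After the congruence T the pencil is (1, P^T diag(d) P), whose generalized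
    eigenvalues are the 1/d_i; pulling the eigenbasis back by T^T diagonalizes
    the original pencil. *)
Lemma loss_congruence (R : realType) (n : nat) (f : R -> R) (A B T P : 'M[R]_n)
    (d : 'rV[R]_n) :
  T \in unitmx -> P *m P^T = 1%:M -> (forall i, 0 < d 0 i) ->
  T *m A *m T^T = 1%:M -> T *m B *m T^T = P^T *m diag_mx d *m P ->
  loss f A B = \sum_(i < n) f (d 0 i)^-1.
Proof.
move=> Tu PP d0 TA TB.
have Pu : P \in unitmx by case/mulmx1_unit: PP.
pose e : 'rV[R]_n := \row_i (d 0 i)^-1.
have de : diag_mx d *m diag_mx e = 1%:M.
  rewrite mulmx_diag -diag_const_mx; congr diag_mx; apply/rowP => i.
  by rewrite !mxE divff // gt_eqF.
have du : diag_mx d \in unitmx by case/mulmx1_unit: de.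
have Bu : B \in unitmx.
  have : T *m B *m T^T \in unitmx by rewrite TB !unitmx_mul unitmx_tr Pu du.
  by rewrite !unitmx_mul => /andP[/andP[]].
rewrite (@loss_diag _ _ f A B (T^T *m P^T) e) //.
- by apply: eq_bigr => i _; rewrite mxE.
- by rewrite unitmx_mul !unitmx_tr Tu.
apply: (can_inj (mulKmx Tu)); rewrite !mulmxA TA TB mul1mx.
by rewrite -[_ *m P *m P^T]mulmxA PP mulmx1 -mulmxA de mulmx1.
Qed.

Lemma spd_congruence (R : realType) (n : nat) (T B : 'M[R]_n) (d : 'rV[R]_n) :
  T \in unitmx -> (forall i, 0 < d 0 i) -> T *m B *m T^T = diag_mx d -> spd B.
Proof.
move=> Tu d0 TB.
have eB : B = invmx T *m diag_mx d *m (invmx T)^T.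
  by rewrite -TB !mulmxA mulVmx // mul1mx -mulmxA -trmx_mul mulVmx // trmx1
    mulmx1.
split; first by rewrite eB !trmx_mul trmxK tr_diag_mx mulmxA.
move=> x x0; pose y := x^T *m invmx T.
have y0 : y != 0.
  apply: contraNneq x0 => y0; rewrite -[x]trmxK -[x^T](mulmxKV Tu) -/y y0.
  by rewrite mul0mx trmx0.
have -> : x^T *m B *m x = y *m diag_mx d *m y^T.
  by rewrite eB /y trmx_mul trmxK !mulmxA.
rewrite diag_quad lt_neqAle eq_sym sumr_ge0 ?andbT; last first.
  by move=> i _; rewrite mulr_ge0 ?sqr_ge0 ?ltW.
apply: contraNneq y0 => sum0; apply/eqP/rowP => i; rewrite [RHS]mxE.
have term_ge0 j : true -> 0 <= d 0 j * y 0 j ^+ 2.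
  by move=> _; rewrite mulr_ge0 ?sqr_ge0 ?ltW.
have /eqP := psumr_eq0P term_ge0 sum0 (erefl (xpredT i)).
by rewrite mulf_eq0 gt_eqF //= sqrf_eq0 => /eqP.
Qed.

(** The entry d_i is the value of the form of B at the i-th row of P
    transported by T^T. *)
Lemma spd_spectrum_gt0 (R : realType) (n : nat) (T B P : 'M[R]_n)
    (d : 'rV[R]_n) :
  spd B -> T \in unitmx -> P *m P^T = 1%:M ->
  T *m B *m T^T = P^T *m diag_mx d *m P -> forall i, 0 < d 0 i.
Proof.
move=> [_ B_pos] Tu PP TB i.
pose e : 'cV[R]_n := delta_mx i 0; pose x := T^T *m P^T *m e.
have Pu : P \in unitmx by case/mulmx1_unit: PP.
have x0 : x != 0.
  apply/eqP => x0; have : e = 0.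
    have Wu : T^T *m P^T \in unitmx by rewrite unitmx_mul !unitmx_tr Tu.
    by rewrite -[LHS](mulKmx Wu) -/x x0 mulmx0.
  by move/matrixP/(_ i 0); rewrite !mxE !eqxx => /eqP; rewrite oner_eq0.
have := B_pos x x0.
have -> : x^T *m B *m x = e^T *m diag_mx d *m e.
  rewrite /x !trmx_mul !trmxK.
  have -> : e^T *m (P *m T) *m B *m (T^T *m P^T *m e)
    = e^T *m (P *m (T *m B *m T^T) *m P^T) *m e by rewrite !mulmxA.
  by rewrite TB !mulmxA -[_ *m P *m P^T]mulmxA PP mulmx1 -[_ *m P *m P^T]mulmxA
    PP mulmx1.
by rewrite trmx_delta -rowE -colE !mxE eqxx.
Qed.

(** * Simultaneous reduction of the two covariances *)

Section Whitening.
Variables (R : realType) (n : nat) (Prec H : 'M[R]_n).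
Variables (delta : 'I_n -> R) (w : 'I_n -> 'cV[R]_n).
Hypothesis w_eigen : forall i : 'I_n, H *m w i = delta i ^+ 2 *: (Prec *m w i).
Hypothesis w_orthonormal : forall i j : 'I_n,
  ((w i)^T *m Prec *m w j) 0 0 = (i == j)%:R.

Let s : 'rV[R]_n := \row_i (1 + delta i ^+ 2).

(** With W the matrix of columns w_i, one has Prec^-1 = W W^T and
    (H + Prec)^-1 = W diag(1/s) W^T, so T = diag(sqrt s) W^-1 works. *)
Lemma whitening : exists T : 'M[R]_n,
  [/\ T \in unitmx, T *m invmx (H + Prec) *m T^T = 1%:M,
      T *m invmx Prec *m T^T = diag_mx s
    & forall i, T *m (w i *m (w i)^T) *m T^T = s 0 i *: delta_mx i i].
Proof.
pose W : 'M[R]_n := \matrix_(a, i) w i a 0.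
have Ww i : W *m delta_mx i 0 = w i.
  by rewrite -colE; apply/colP => a; rewrite !mxE.
have WPW : W^T *m Prec *m W = 1%:M.
  apply/matrixP => i j; rewrite [RHS]mxE -w_orthonormal -!Ww trmx_mul.
  rewrite -[LHS]mulr1n.
  pose e k : 'cV[R]_n := delta_mx k 0; rewrite -![delta_mx _ _]/(e _).
  have -> : (e i)^T *m W^T *m Prec *m (W *m e j)
    = (e i)^T *m (W^T *m Prec *m W) *m e j by rewrite !mulmxA.
  by rewrite trmx_delta -rowE -colE !mxE.
have Wu : W \in unitmx by case/mulmx1_unit: WPW.
have WWP : W *m W^T *m Prec = 1%:M by rewrite -mulmxA; apply: mulmx1C.
have PWW := mulmx1C WWP.
have Pu : Prec \in unitmx by case/mulmx1_unit: WWP.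
have invP : invmx Prec = W *m W^T by rewrite -[RHS](mulmxK Pu) WWP mul1mx.
have s_gt0 i : 0 < s 0 i by rewrite mxE ltr_pwDl ?sqr_ge0.
pose Si := diag_mx (\row_i (s 0 i)^-1).
have HP : (H + Prec) *m W = Prec *m W *m diag_mx s.
  have entryW X a i : (X *m W) a i = (X *m w i) a 0
    by rewrite -Ww mulmxA -colE [RHS]mxE.
  apply/matrixP => a i; rewrite entryW mulmxDl w_eigen mul_mx_diag [RHS]mxE
    entryW.
  by rewrite [s 0 i]mxE [LHS]mxE [X in X + _]mxE; ring.
have HPu : (H + Prec) *m (W *m Si *m W^T) = 1%:M.
  rewrite !mulmxA HP -[_ *m Si]mulmxA.
  have -> : diag_mx s *m Si = 1%:M.
    rewrite mulmx_diag -diag_const_mx; congr diag_mx; apply/rowP => i.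
    by rewrite [LHS]mxE [X in _ * X]mxE [RHS]mxE divff // gt_eqF.
  by rewrite mulmx1 -mulmxA.
have Hu : H + Prec \in unitmx by case/mulmx1_unit: HPu.
have invHP : invmx (H + Prec) = W *m Si *m W^T
  by rewrite -[RHS](mulKmx Hu) HPu mulmx1.
pose S := diag_mx (\row_i Num.sqrt (s 0 i)).
have SS : S *m S = diag_mx s.
  rewrite mulmx_diag; congr diag_mx; apply/rowP => i.
  by rewrite [LHS]mxE [X in _ * X]mxE [X in X * _]mxE -expr2 sqr_sqrtr ?ltW.
have trS : S^T = S by rewrite tr_diag_mx.
pose T := S *m invmx W.
have TW : T *m W = S by rewrite /T -mulmxA mulVmx // mulmx1.
have WT : W^T *m T^T = S by rewrite -trmx_mul TW.
have Su : S \in unitmx.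
  rewrite unitmxE det_diag unitfE; apply/prodf_neq0 => i _.
  by rewrite mxE gt_eqF // sqrtr_gt0.
exists T; split.
- by rewrite unitmx_mul Su unitmx_inv.
- rewrite invHP !mulmxA TW -mulmxA WT; apply/matrixP => i j.
  rewrite mul_mx_diag mxE mul_mx_diag mxE !mxE.
  have [->|ij] := eqVneq i j; last by rewrite !mulr0n !mul0r.
  rewrite !mulr1n mulrAC -expr2 sqr_sqrtr ?divff ?addr_ge0 ?sqr_ge0 //.
  by have := s_gt0 j; rewrite mxE => /gt_eqF ->.
- by rewrite invP !mulmxA TW -mulmxA WT SS.
move=> i; rewrite mulmxA -{1}Ww mulmxA TW -Ww trmx_mul -mulmxA.
rewrite -[_ *m W^T *m T^T]mulmxA WT.
rewrite trmx_delta mulmxA -[S *m _ *m _]mulmxA mul_delta_mx.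
apply/matrixP => a b; rewrite mul_mx_diag mxE mul_diag_mx !mxE.
case: (eqVneq a i) => [->|]; last by rewrite !mulr0 mul0r.
case: (eqVneq b i) => [->|]; last by rewrite !mulr0 mul0r.
rewrite !mulr1 -expr2 sqr_sqrtr //.
by have := s_gt0 i; rewrite mxE => /ltW.
Qed.

End Whitening.

(** * The optimal posterior covariance *)

Theorem theorem2p3 (R : realType) (m n : nat)
    (G : 'M[R]_(m, n)) (Gobs : 'M[R]_m) (Gpr : 'M[R]_n)
    (Gobs_spd : spd Gobs) (Gpr_spd : spd Gpr)
    (delta : 'I_n -> R) (w : 'I_n -> 'cV[R]_n)
    (w_eigen : forall i : 'I_n,
       hessian G Gobs *m w i = delta i ^+ 2 *: (invmx Gpr *m w i))
    (delta_sorted : forall i j : 'I_n,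
       (i <= j)%N -> delta j ^+ 2 <= delta i ^+ 2)
    (w_orthonormal : forall i j : 'I_n,
       ((w i)^T *m invmx Gpr *m w j) 0 0 = (i == j)%:R)
    (f : R -> R) (f_U : classU f)
    (r : nat) (r_ge1 : (1 <= r)%N) (r_len : (r <= n)%N) :
  let Gpos := posterior_cov G Gobs Gpr in
  let Ghat := Gpr - \sum_(i < n | (i < r)%N)
    (delta i ^+ 2 * (1 + delta i ^+ 2)^-1) *: (w i *m (w i)^T) in
  [/\ minimizer_on (classM Gpr r) (loss f Gpos) Ghat,
      loss f Gpos Ghat
        = f 1 * r%:R + \sum_(i < n | (r <= i)%N) f (1 / (1 + delta i ^+ 2))
    & (forall i j : 'I_n, (i < r)%N -> j != i -> delta i ^+ 2 != delta j ^+ 2) ->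
      forall B : 'M[R]_n,
        minimizer_on (classM Gpr r) (loss f Gpos) B -> B = Ghat].
Proof.
move=> Gpos Ghat.
pose s : 'rV[R]_n := \row_i (1 + delta i ^+ 2).
have s1 i : 1 <= s 0 i by rewrite mxE lerDl sqr_ge0.
have s_sorted (k l : 'I_n) : (k <= l)%N -> s 0 l <= s 0 k.
  by move=> kl; rewrite !mxE lerD2l delta_sorted.
have [T []] := whitening w_eigen w_orthonormal.
rewrite -/s invmxK -[invmx _]/Gpos => Tu TGpos TGpr Tw.
have trT_inj (A B : 'M[R]_n) : T *m A *m T^T = T *m B *m T^T -> A = B.
  move=> e; apply: (can_inj (mulKmx Tu)).
  have Tu' : T^T \in unitmx by rewrite unitmx_tr.
  exact: (can_inj (mulmxK Tu')).
have TGhat : T *m Ghat *m T^T = diag_mx (deflated s r).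
  rewrite /Ghat mulmxBr mulmxBl TGpr mulmx_sumr mulmx_suml.
  rewrite (eq_bigr (fun i => (delta i ^+ 2) *: delta_mx i i)); last first.
    move=> i _; rewrite -scalemxAr -scalemxAl Tw scalerA mxE mulfVK //.
    by have := s1 i; rewrite mxE => /(lt_le_trans ltr01)/gt_eqF ->.
  apply/matrixP => a b; rewrite [LHS]mxE [X in _ + X]mxE summxE.
  under eq_bigr => i _ do rewrite !mxE.
  have [->|ab] := eqVneq a b; last first.
    rewrite !mxE (negPf ab) !mulr0n big1 ?subr0 // => i _.
    by case: (eqVneq a i) ab => [->|_ _];
      rewrite ?mulr0 //= eq_sym => /negPf ->; rewrite mulr0.
  rewrite !mxE eqxx !mulr1n; case: ltnP => [br|rb].
    rewrite (bigD1 b) //= eqxx mulr1 big1 ?addr0 ?addrK // => i /andP[_ ib].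
    by rewrite eq_sym (negPf ib) mulr0.
  rewrite big1 ?subr0 // => i ir; have /negPf -> : b != i.
    by apply: contraTneq ir => <-; rewrite -leqNgt.
  by rewrite mulr0.
have deflated_gt0 i : 0 < deflated s r 0 i.
  by rewrite mxE; case: ifP => // _; apply: lt_le_trans (s1 i).
have Ghat_spd : spd Ghat := spd_congruence Tu deflated_gt0 TGhat.
have Ghat_M : classM Gpr r Ghat.
  split=> //; pose c i := delta i ^+ 2 * (1 + delta i ^+ 2)^-1.
  pose v (k : 'I_r) := widen_ord r_len k.
  exists r, (\matrix_(a, k) (Num.sqrt (c (v k)) * w (v k) a 0)).
  split; first exact: rank_leq_col.
  congr (_ - _); rewrite (big_ord_narrow r_len) /=.
  apply/matrixP => a b; rewrite summxE mxE; apply: eq_bigr => k _.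
  have c_ge0 : 0 <= c (v k) by rewrite mulr_ge0 ?invr_ge0 ?addr_ge0 ?sqr_ge0.
  by rewrite !mxE big_ord1 !mxE [RHS]mulrACA -[X in _ = X * _]expr2 sqr_sqrtr.
have loss_Ghat : loss f Gpos Ghat = \sum_i f (deflated s r 0 i)^-1.
  apply: (loss_congruence f Tu (P := 1%:M) _ deflated_gt0 TGpos).
    by rewrite trmx1 mulmx1.
  by rewrite TGhat trmx1 mul1mx mulmx1.
have classM_spectrum B : classM Gpr r B -> exists p (M : 'M[R]_(n, p)) P d,
    [/\ (\rank M <= r)%N, T *m B *m T^T = diag_mx s - M *m M^T, P *m P^T = 1%:M,
        diag_mx s - M *m M^T = P^T *m diag_mx d *m P & forall i, 0 < d 0 i] /\
    (forall i : 'I_n, (r <= i)%N -> s 0 i <= d 0 i) /\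
    loss f Gpos B = \sum_i f (d 0 i)^-1.
  move=> [B_spd [p [K [rK eB]]]]; pose M := T *m K.
  have rM : (\rank M <= r)%N by apply: leq_trans (mxrankM_maxr _ _) rK.
  have TB : T *m B *m T^T = diag_mx s - M *m M^T.
    by rewrite eB mulmxBr mulmxBl TGpr /M trmx_mul !mulmxA.
  have [P [d [PP eA sd]]] := aligned_spectral s_sorted rM r_len.
  have d0 := spd_spectrum_gt0 B_spd Tu PP (etrans TB eA).
  exists p, M, P, d; split=> //; split=> //.
  exact: (loss_congruence f Tu PP d0 TGpos (etrans TB eA)).
have Ghat_min B : classM Gpr r B -> loss f Gpos Ghat <= loss f Gpos B.
  move=> /classM_spectrum [p [M [P [d [[_ _ _ _ d0] [sd ->]]]]]].
  by rewrite loss_Ghat; apply: loss_bound.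
split; first by split.
  rewrite loss_Ghat (bigID (fun i : 'I_n => (i < r)%N)) /=; congr (_ + _).
    rewrite (big_ord_narrow r_len) /=.
    under eq_bigr => k _ do rewrite mxE /= ltn_ord invr1.
    by rewrite sumr_const card_ord mulr_natr.
  apply: eq_big => [i|i]; first by rewrite -leqNgt.
  by move=> /negPf ir; rewrite !mxE ir div1r.
move=> delta_gap B [BM B_min]; apply: trT_inj; rewrite TGhat.
have [p [M [P [d [[rM -> PP eA d0] [sd lossB]]]]]] := classM_spectrum B BM.
have d_deflated : d = deflated s r.
  apply: (loss_bound_eq f_U s1 d0 sd); rewrite -lossB -loss_Ghat.
  exact: B_min.
rewrite d_deflated in eA.
(* The separating value is s_r; for r = n nothing bounds it from below, and
   any c < 1 will do. *)
have [c [cs sc]] : exists c, (forall i : 'I_n, (i < r)%N -> c < s 0 i) /\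
    (forall i : 'I_n, (r <= i)%N -> s 0 i <= c).
  have [nr|rn] := leqP n r.
    exists 0; split=> i; first by move=> _; apply: lt_le_trans (s1 i).
    by move=> /(leq_trans nr); rewrite leqNgt ltn_ord.
  exists (s 0 (Ordinal rn)); split=> i ir; last exact: s_sorted.
  rewrite !mxE ltrD2l lt_neqAle delta_sorted ?(ltnW ir) // andbT eq_sym.
  apply: delta_gap => //; apply/eqP => ri.
  by move: ir; rewrite -ri /= ltnn.
exact: deflated_unique PP eA rM r_len s1 cs sc.
Qed.
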